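(* Let $n\ge 3$, let $\mathbb{F}$ be $\mathbb{R}$ or $\mathbb{C}$, and let $\phi:M_n(\mathbb{F})\to M_n(\mathbb{F})$ be a bijective map. Then the following are equivalent: (1) $\phi$ is completely quadratic preserving in both directions, i.e. for every $k\in\mathbb{N}$ and every $T\in M_n(\mathbb{F})\otimes M_k$, $T$ is quadratic if and only if $\phi_k(T)$ is quadratic. (2) $\phi$ is 2-quadratic preserving in both directions, i.e. for every $T\in M_n(\mathbb{F})\otimes M_2$, $T$ is quadratic if and only if $\phi_2(T)$ is quadratic. (3) There exist an invertible matrix $A\in M_n(\mathbb{F})$, a scalar $\lambda$ and a field automorphism $\tau:\mathbb{F}\to\mathbb{F}$ such that $\phi(T)=\lambda A T_\tau A^{-1}$ for all $T\in M_n(\mathbb{F})$, where $T_\tau=(\tau(t_{ij}))$ for $T=(t_{ij})$.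
   Context: A square matrix (or block matrix) $T$ is quadratic if there exist scalars $a,b$ with $(T-aI)(T-bI)=0$. For a map $\phi$ on $M_n(\mathbb{F})$ and $k\in\mathbb{N}$, $\phi_k$ acts on $k\times k$ block matrices with entries in $M_n(\mathbb{F})$ by $\phi_k((a_{ij})_{k\times k})=(\phi(a_{ij}))_{k\times k}$. *)

(* Defs.v *)
From HB Require Import structures.
From mathcomp Require Import all_boot all_order all_algebra.
From mathcomp Require Import complex.
From mathcomp Require Import reals.
Set Implicit Arguments. Unset Strict Implicit. Unset Printing Implicit Defensive.
Import GRing.Theory.
Local Open Scope ring_scope.

Definition quadratic (F : fieldType) (m : nat) (T : 'M[F]_m) : Prop :=
  exists a b : F, (T - a%:M) *m (T - b%:M) = 0.

(* A k x k block matrix with entries in M_n(F) (an element of M_n(F) (x) M_k),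
   given by its blocks B i j, assembled as an honest square matrix. *)
Definition blockmx (F : fieldType) (n k : nat) (B : 'I_k -> 'I_k -> 'M[F]_n)
  : 'M[F]_(\sum_(i < k) n) :=
  \mxblock_(i < k, j < k) B i j.

Definition phik (F : fieldType) (n k : nat) (phi : 'M[F]_n -> 'M[F]_n)
  (B : 'I_k -> 'I_k -> 'M[F]_n) : 'M[F]_(\sum_(i < k) n) :=
  blockmx (fun i j => phi (B i j)).

Definition k_quadratic_preserving_both (F : fieldType) (n k : nat)
  (phi : 'M[F]_n -> 'M[F]_n) : Prop :=
  forall B : 'I_k -> 'I_k -> 'M[F]_n,
    quadratic (blockmx B) <-> quadratic (phik phi B).

Definition completely_quadratic_preserving_both (F : fieldType) (n : nat)
  (phi : 'M[F]_n -> 'M[F]_n) : Prop :=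
  forall k : nat, k_quadratic_preserving_both k phi.

Definition standard_form (F : fieldType) (n : nat) (phi : 'M[F]_n -> 'M[F]_n) : Prop :=
  exists (A : 'M[F]_n) (lambda : F) (tau : {rmorphism F -> F}),
    [/\ A \in unitmx, bijective tau &
        forall T : 'M[F]_n, phi T = lambda *: (A *m map_mx tau T *m invmx A)].

Definition theorem_conditions_equiv (F : fieldType) (n : nat)
  (phi : 'M[F]_n -> 'M[F]_n) : Prop :=
  [/\ completely_quadratic_preserving_both phi <-> k_quadratic_preserving_both 2 phi,
      k_quadratic_preserving_both 2 phi <-> standard_form phi &
      standard_form phi <-> completely_quadratic_preserving_both phi].

(* Main.v *)
Require Import Defs.
From HB Require Import structures.
From mathcomp Require Import all_boot all_order all_algebra.
From mathcomp Require Import complex.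
From mathcomp Require Import reals.
From mathcomp Require Import ring.
Set Implicit Arguments. Unset Strict Implicit. Unset Printing Implicit Defensive.
Import GRing.Theory.
Local Open Scope ring_scope.

(* For an invertible [B], the block matrix ((A, B), (C, D)) is quadratic exactly
   when D = s - B^-1 A B and C = B^-1 (s A - p - A^2) for some a, b with s = a + b
   and p = a b. A 2-quadratic preserver therefore respects conjugation and left
   multiplication up to scalars. Testing on scalars, on matrices squaring to zero
   and on idempotents shows that, after scaling so that phi 1 = 1, phi maps the
   scalar c to tau c for a field automorphism tau, and that it maps square-zero
   matrices and idempotents to such matrices compatibly with tau. The images of
   the matrix units again form a system of matrix units, so after undoing tau and
   a conjugation phi fixes scalars and matrix units. Transvections then move the
   fixed matrix units to all rank one matrices; conjugating these fixes every
   invertible matrix, hence every idempotent, hence every product of an invertible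
   matrix and an idempotent, that is, every matrix. *)

(** * Quadratic preservers of an abstract algebra *)

Section Algebra.
Variables (F : fieldType) (R : unitAlgType F).
Implicit Types (A B C D X Y Z N P : R) (a b c s p k x y : F) (phi psi : R -> R).

(** * Scalars, and coordinates in the span of 1 and one element *)

Definition scal X := exists c, X = c%:A.

Lemma alg_inj a b : a%:A = b%:A :> R -> a = b.
Proof.
move/eqP; rewrite -subr_eq0 -scalerBl scaler_eq0 oner_eq0 orbF subr_eq0.
by move/eqP.
Qed.

(** Coordinates in the span of [Y] and 1. When [Y] is not scalar, equations in this span are solved
    by comparing coefficients. *)
Definition lin Y x y : R := x *: Y + y%:A.

Lemma linE Y : Y = lin Y 1 0. Proof. by rewrite /lin scale1r scale0r addr0. Qed.

Lemma lin_inj Y x y x' y' : ~ scal Y -> lin Y x y = lin Y x' y' -> x = x' /\ y = y'.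
Proof.
move=> nY E.
have E1 : (x - x') *: Y = (y' - y)%:A.
  apply/eqP; rewrite !scalerBl subr_eq addrAC eq_sym subr_eq eq_sym.
  by apply/eqP; rewrite [RHS]addrC; exact: E.
have [xx|nx] := eqVneq x x'.
  split=> //; move/eqP: E1; rewrite xx subrr scale0r eq_sym scaler_eq0 oner_eq0.
  by rewrite orbF subr_eq0 => /eqP.
case: nY; exists ((x - x')^-1 * (y' - y)).
by rewrite -scalerA -E1 scalerA mulVf ?scale1r // subr_eq0.
Qed.

Lemma linZ Y c x y : c *: lin Y x y = lin Y (c * x) (c * y).
Proof. by rewrite /lin scalerDr !scalerA. Qed.

Lemma linM Y k x y x' y' : Y * Y = k *: Y ->
  lin Y x y * lin Y x' y' = lin Y (k * x * x' + x * y' + y * x') (y * y').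
Proof.
move=> YY; rewrite /lin mulrDl !mulrDr !mulr_algl !mulr_algr -!scalerAr -!scalerAl YY.
rewrite !scalerA !scalerDl !addrA; congr (_ *: _ + _ + _ + _); try ring.
by rewrite mulrC.
Qed.

(* The 2 x 2 block matrix ((A, B), (C, D)) is annihilated by (X - a)(X - b). *)
Definition quad2 A B C D := exists a b,
  [/\ A * A + B * C = (a + b) *: A - (a * b)%:A,
      A * B + B * D = (a + b) *: B,
      C * A + D * C = (a + b) *: C &
      C * B + D * D = (a + b) *: D - (a * b)%:A].

(** * Quadratic 2 x 2 block matrices with special blocks *)

Lemma quad2_of_idem s A B C D : A * A + B * C = s *: A -> A * B + B * D = s *: B ->
  C * A + D * C = s *: C -> C * B + D * D = s *: D -> quad2 A B C D.
Proof. by move=> *; exists s, 0; rewrite addr0 mulr0 scale0r !subr0. Qed.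

Lemma alg_eq0 a : a%:A = 0 :> R -> a = 0.
Proof. by rewrite -(scale0r 1); apply: alg_inj. Qed.

(** A zero bottom row forces [a * b = 0], so the block matrix squares to a multiple of itself. In
    this way [Y * B = s *: B] becomes a relation that a preserver transports. *)
Lemma quad2_row Y B : quad2 Y B 0 0 <-> exists s, Y * Y = s *: Y /\ Y * B = s *: B.
Proof.
split=> [[a [b]]|[s [h1 h2]]]; last first.
  by apply: (@quad2_of_idem s); rewrite ?(mulr0, mul0r, addr0, scaler0).
rewrite !(mulr0, mul0r, addr0, scaler0) sub0r => -[h1 h2 _ h4].
move/esym/eqP: h4; rewrite oppr_eq0 => /eqP E.
by exists (a + b); rewrite h1 E subr0.
Qed.

Lemma quad2_col B D : quad2 0 B 0 D <-> exists s, D * D = s *: D /\ B * D = s *: B.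
Proof.
split=> [[a [b]]|[s [h1 h2]]]; last first.
  by apply: (@quad2_of_idem s); rewrite ?(mulr0, mul0r, addr0, add0r, scaler0).
rewrite !(mulr0, mul0r, addr0, add0r, scaler0) => -[h1 h2 _ h4].
move/esym/eqP: h1; rewrite oppr_eq0 => /eqP E.
by exists (a + b); rewrite h4 E subr0.
Qed.

Lemma quad2_anti B C : quad2 0 B C 0 -> exists q, B * C = q%:A /\ C * B = q%:A.
Proof.
case=> a [b]; rewrite !(mulr0, mul0r, addr0, add0r, scaler0) => -[h1 _ _ h4].
by exists (- (a * b)); rewrite h1 h4 scaleNr.
Qed.

(** The equations of the top row dictate [C] and [D]; those of the bottom row then follow because
    [K], a polynomial in [A], commutes with [A]. *)
Lemma quad2_unit A B a b : B \is a GRing.unit ->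
  quad2 A B (B^-1 * ((a + b) *: A - (a * b)%:A - A * A)) ((a + b)%:A - B^-1 * A * B).
Proof.
move=> uB; exists a, b; set p := a * b; set s := a + b.
set A1 := B^-1 * A * B; set K := s *: A - p%:A - A * A.
have AB : A * B = B * A1 by rewrite /A1 -mulrA mulVKr.
have BA : B^-1 * A = A1 * B^-1 by rewrite /A1 mulrK.
have KA : K * A = A * K.
  by rewrite /K !mulrBl !mulrBr mulr_algl mulr_algr -scalerAl -scalerAr mulrA.
have KB : B^-1 * K * B = s *: A1 - p%:A - A1 * A1.
  rewrite /K !mulrBr !mulrBl mulr_algr -!scalerAr -!scalerAl mulVr //.
  by rewrite -/A1 mulrA BA -[A1 * B^-1 * A]mulrA BA !mulrA mulrVK.
split.
- by rewrite mulVKr // addrC subrK.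
- by rewrite AB mulrBr mulr_algr addrC subrK.
- by rewrite mulrBl mulr_algl -mulrA KA !mulrA BA addrC subrK.
- rewrite KB [X in _ + X]mulrBl mulr_algl [A1 * (_ - _)]mulrBr mulr_algr.
  by rewrite [X in X + _]addrAC [LHS]addrC addrA subrK.
Qed.

(** Cancelling the invertible [B] in the two top equations solves them for [C] and [D]. *)
Lemma quad2_unitP A B C D : B \is a GRing.unit -> quad2 A B C D ->
  exists s p, C = B^-1 * (s *: A - p%:A - A * A) /\ D = s%:A - B^-1 * A * B.
Proof.
move=> uB [a [b [h1 h2 _ _]]]; exists (a + b), (a * b); split.
  by apply: (mulrI uB); rewrite mulVKr // -h1 addrC addKr.
apply: (mulrI uB); rewrite mulrBr mulr_algr -!mulrA mulVKr // -h2.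
by rewrite addrC addKr.
Qed.

(** * Preservers of quadratic 2 x 2 block matrices: zero, scalars, units *)

Hypothesis charF2 : 2%:R != 0 :> F.
Hypothesis center_scal : forall Z, (forall Y, Z * Y = Y * Z) -> scal Z.
Hypothesis nonunit_idem : forall X, X \isn't a GRing.unit ->
  exists D, [/\ ~ scal D, D * D = D & D * X = X].

(** The inverse [psi] is explicit so that every result about [phi] can be applied to it as well. *)
Definition qpres phi psi := [/\ cancel phi psi, cancel psi phi &
  forall A B C D, quad2 A B C D <-> quad2 (phi A) (phi B) (phi C) (phi D)].

Lemma qpres_sym phi psi : qpres phi psi -> qpres psi phi.
Proof. by case=> K K' h; split=> // A B C D; rewrite (h (psi A)) !K'. Qed.

Lemma exists_nonscal : exists Y, ~ scal Y.
Proof. by case: (@nonunit_idem 0) => [|D [nD _ _]]; [rewrite unitr0|exists D]. Qed.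

(** A block matrix with a single nonzero block, off the diagonal, squares to zero, hence
    [quad2 Z Y Z Z] for every [Y]. The diagonal equations make [Z] central, so a scalar [z]; for
    nonscalar [Y] the coefficient of [Y] in the first of them gives [z = 0]. *)
Lemma qpres0 phi psi : qpres phi psi -> phi 0 = 0.
Proof.
case=> K K' h; set Z := phi 0.
have q Y : quad2 Z Y Z Z.
  rewrite -(K' Y) -h; exists 0, 0.
  by rewrite !(mulr0, mul0r, addr0, scaler0, scale0r, subr0).
have cZ Y : Z * Y = Y * Z.
  have [a [b [h1 _ _ h4]]] := q Y.
  by apply: (addIr (Z * Z)); rewrite h4 [RHS]addrC h1.
have [z Ez] := center_scal cZ.
have [Y nY] := exists_nonscal.
have [a [b [h1 h2 _ _]]] := q Y.
have [z0 _] : z = 0 /\ z * z = (a + b) * z - a * b.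
  apply: (lin_inj nY); rewrite /lin scale0r add0r addrC scalerBl.
  by rewrite -!(scalerA z) -(scalerA (a + b)) -Ez -h1 -cZ Ez !mulr_algl.
by rewrite Ez z0 scale0r.
Qed.

(** The block matrix ((0, [phi 1]), (0, c)) is quadratic whatever [phi 1] is; pulled back, its
    second column says that 1 times [psi c%:A] is a multiple of 1. *)
Lemma qpres_algP phi psi c : qpres phi psi -> scal (psi c%:A).
Proof.
move=> h; have [K K' hq] := h.
have p0 := qpres0 h.
have : quad2 (phi 0) (phi 1) (phi 0) (phi (psi c%:A)).
  by rewrite p0 K'; apply/quad2_col; exists c; rewrite !mulr_algl mulr_algr.
by case/(proj2 (hq _ _ _ _))/quad2_col => s [_ E]; exists s; rewrite -E mul1r.
Qed.

Lemma qpres_scal phi psi X : qpres phi psi -> scal (phi X) <-> scal X.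
Proof.
move=> h; have [K _ _] := h; split=> [|[c ->]]; last exact: qpres_algP (qpres_sym h).
by case=> c E; rewrite -(K X) E; apply: qpres_algP h.
Qed.

(** If [Z] is singular, the row ([D], [Z]) with [D * Z = Z] is quadratic. Were [phi Z] invertible,
    cancelling it would make [phi D], and so [D], scalar. *)
Lemma qpres_unit phi psi X : qpres phi psi -> phi X \is a GRing.unit <-> X \is a GRing.unit.
Proof.
have aux f g Z : qpres f g -> f Z \is a GRing.unit -> Z \is a GRing.unit.
  move=> h uZ; have [_ _ hq] := h; have p0 := qpres0 h.
  apply/negPn/negP => /nonunit_idem[D [nD DD DZ]]; apply: nD.
  have /hq : quad2 D Z 0 0 by apply/quad2_row; exists 1; rewrite !scale1r.
  rewrite p0 => /quad2_row[s [_ E]]; apply/(qpres_scal _ h).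
  by exists s; apply: (mulIr uZ); rewrite E mulr_algl.
move=> h; split; first exact: aux h.
by move=> uX; apply: (aux _ _ _ (qpres_sym h)); case: h => ->.
Qed.

(** The source of all functional equations below: complete the row ([A], [B]) to a quadratic block
    matrix, apply [phi], and use that the completion of the image row is forced up to two
    scalars. *)
Lemma qpres_conj phi psi A B a b : qpres phi psi -> B \is a GRing.unit ->
  exists s p, phi (B^-1 * ((a + b) *: A - (a * b)%:A - A * A)) =
      (phi B)^-1 * (s *: phi A - p%:A - phi A * phi A) /\
    phi ((a + b)%:A - B^-1 * A * B) = s%:A - (phi B)^-1 * phi A * phi B.
Proof.
move=> h uB; have [_ _ hq] := h.
by apply: quad2_unitP; [apply/(qpres_unit _ h)|apply: (proj1 (hq _ _ _ _)); apply: quad2_unit].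
Qed.

Lemma qpres_conj_sq phi psi A B k k' s : qpres phi psi -> B \is a GRing.unit ->
  A * A = k *: A -> phi A * phi A = k' *: phi A ->
  exists s' p, phi ((s - k) *: (B^-1 * A)) = (phi B)^-1 * lin (phi A) (s' - k') p /\
    phi (s%:A - B^-1 * A * B) = s'%:A - (phi B)^-1 * phi A * phi B.
Proof.
move=> h uB AA AA'; have [s' [p []]] := qpres_conj A s 0 h uB.
rewrite addr0 mulr0 scale0r subr0 AA AA' -scalerBl -scalerAr => h1 h2.
exists s', (- p); split=> //.
by rewrite h1 /lin addrAC -scalerBl scaleNr.
Qed.

Lemma qpres_sq phi psi Y : qpres phi psi ->
  (exists s, Y * Y = s *: Y) <-> (exists s, phi Y * phi Y = s *: phi Y).
Proof.
move=> h; have [_ _ hq] := h; have p0 := qpres0 h.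
have E Z : (exists s, Z * Z = s *: Z) <-> quad2 Z 0 0 0.
  rewrite quad2_row; split=> -[s]; last by case; exists s.
  by exists s; rewrite mulr0 scaler0.
by rewrite !E hq p0.
Qed.

Lemma sqz_nonscal N : N * N = 0 -> N != 0 -> ~ scal N.
Proof.
move=> NN N0 [c E]; move: NN N0; rewrite E mulr_algl scalerA => /alg_eq0/eqP.
by rewrite mulf_eq0 orbb => /eqP ->; rewrite scale0r eqxx.
Qed.

Definition npres phi psi (tau : F -> F) :=
  [/\ qpres phi psi, phi 1 = 1 & forall c, phi c%:A = (tau c)%:A].

Lemma lin_eq0 Y x y : ~ scal Y -> x *: Y + y%:A = 0 -> x = 0 /\ y = 0.
Proof. by move=> nY E; apply: (lin_inj nY); rewrite /lin E !scale0r addr0. Qed.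

(** * Maps with [phi 1 = 1]: square-zero elements, idempotents and [tau] *)

Section Normalised.
Variables (phi psi : R -> R) (tau : F -> F).
Hypothesis hn : npres phi psi tau.

Let h : qpres phi psi. Proof. by case: hn. Qed.
Let hq A B C D : quad2 A B C D -> quad2 (phi A) (phi B) (phi C) (phi D).
Proof. by case: h => _ _ hh; apply: (proj1 (hh _ _ _ _)). Qed.
Let p0 : phi 0 = 0. Proof. exact: qpres0 h. Qed.
Lemma npres_row s Y B : Y * Y = s *: Y -> Y * B = s *: B ->
  exists t, phi Y * phi Y = t *: phi Y /\ phi Y * phi B = t *: phi B.
Proof.
by move=> YY YB; apply/quad2_row; rewrite -p0; apply: hq; apply/quad2_row; exists s.
Qed.
Lemma npres_col s B D : D * D = s *: D -> B * D = s *: B ->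
  exists t, phi D * phi D = t *: phi D /\ phi B * phi D = t *: phi B.
Proof.
by move=> DD BD; apply/quad2_col; rewrite -p0; apply: hq; apply/quad2_col; exists s.
Qed.
Let p1 : phi 1 = 1. Proof. by case: hn. Qed.
Let pc c : phi c%:A = (tau c)%:A. Proof. by case: hn. Qed.
Let nons Y : ~ scal Y -> ~ scal (phi Y). Proof. by rewrite (qpres_scal _ h). Qed.
Let sq Y k : Y * Y = k *: Y -> exists s, phi Y * phi Y = s *: phi Y.
Proof. by move=> YY; apply: (proj1 (qpres_sq Y h)); exists k. Qed.

(** Two test matrices suffice: the row ([N], [- N]), and ((N, 1), (0, -N)), which squares to zero
    and yields [phi (- N) = s - phi N]. Comparing coefficients leaves only [s = t = 0]. *)
Lemma qpres_sqz_opp N : N * N = 0 -> phi N * phi N = 0 /\ phi (- N) = - phi N.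
Proof.
move=> NN; have [->|N0] := eqVneq N 0; first by rewrite oppr0 p0 mulr0 oppr0.
have nN := sqz_nonscal NN N0; have nN' := nons nN.
have [||t []] := @npres_row 0 N (- N); rewrite ?mulrN ?NN ?oppr0 ?scale0r // => NN' Nn.
have /hq : quad2 N 1 0 (- N).
  by apply: (@quad2_of_idem 0); rewrite ?mulrNN ?NN ?mulr0 ?mul0r ?mulr1 ?mul1r ?addr0
     ?scale0r ?subrr.
rewrite p1 p0 => /quad2_unitP[|s [p]]; first exact: unitr1.
rewrite invr1 !mul1r mulr1 => -[E En]; move: Nn; rewrite En.
rewrite mulrBr mulr_algr NN' -scalerBl => E2.
move: E; rewrite NN' addrAC -scalerBl -scaleNr => /esym/(lin_eq0 nN')[].
move/subr0_eq => st _; move: E2.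
rewrite st subrr scale0r scalerBr addrC -scaleNr scalerA => /esym/(lin_eq0 nN')[/eqP].
rewrite oppr_eq0 => /eqP t0 _.
by rewrite t0 !scale0r sub0r.
Qed.

Let tau0 : tau 0 = 0.
Proof. by apply: alg_inj; rewrite -pc !scale0r. Qed.

Lemma npres_tau1 : tau 1 = 1.
Proof. by apply: alg_inj; rewrite -pc !scale1r. Qed.

Let tau_neq0 b : b != 0 -> tau b != 0.
Proof.
apply: contraNneq => tb0; have [K _ _] := h.
by apply/eqP/alg_eq0; rewrite -(K b%:A) pc tb0 scale0r -p0 K.
Qed.

Lemma unit_alg b : b != 0 -> (b%:A : R) \is a GRing.unit.
Proof.
by move=> b0; apply/unitrP; exists b^-1%:A; rewrite !mulr_algl !scalerA mulfV // mulVf // scale1r.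
Qed.

Lemma inv_alg b : b != 0 -> (b%:A : R)^-1 = b^-1%:A.
Proof.
by move=> b0; apply: (mulrI (unit_alg b0)); rewrite divrr ?unit_alg // mulr_algl scalerA
  mulfV // scale1r.
Qed.

(** Here the conjugating element is the scalar [b]. The second formula determines [s'] without
    reference to [b], so first formulas for different [b] can be compared. *)
Lemma npres_conj_alg A b k k' s : b != 0 ->
  A * A = k *: A -> phi A * phi A = k' *: phi A ->
  exists s' p, phi (((s - k) / b) *: A) = (tau b)^-1 *: lin (phi A) (s' - k') p /\
    phi (s%:A - A) = s'%:A - phi A.
Proof.
move=> b0 AA AA'; have [s' [p []]] := qpres_conj_sq s h (unit_alg b0) AA AA'.
rewrite pc !inv_alg ?tau_neq0 // !mulr_algl !mulr_algr !scalerA !mulfV ?tau_neq0 //.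
by rewrite !scale1r; exists s', p.
Qed.

Let npres_sqz_neq0 N s b : N * N = 0 -> N != 0 -> s != 0 -> b != 0 ->
  phi ((s / b) *: N) = (tau s / tau b) *: phi N /\ phi (s%:A - N) = (tau s)%:A - phi N.
Proof.
move=> NN N0 s0 b0; have [NN' _] := qpres_sqz_opp NN.
have nN' := nons (sqz_nonscal NN N0).
have aux t c : c != 0 -> exists t', phi ((t / c) *: N) = (t' / tau c) *: phi N /\
    phi (t%:A - N) = t'%:A - phi N.
  move=> c0; have [||t' [p []]] := @npres_conj_alg N c 0 0 t c0; rewrite ?scale0r //.
  rewrite !subr0 => E ->; exists t'; split=> //.
  (* The image squares to zero again, which forces [p = 0]. *)
  have [] := @qpres_sqz_opp ((t / c) *: N).
    by rewrite -scalerAl -scalerAr NN !scaler0.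
  rewrite E linZ (@linM _ 0) ?scale0r // => /(lin_eq0 nN')[_ /eqP].
  rewrite mulf_eq0 orbb => /eqP -> _.
  by rewrite /lin scale0r addr0 mulrC.
have [t [Et1 Et2]] := aux s b b0.
(* With denominator [s] the element is [N] itself, so [t' = tau s]; by the second formula [t']
   equals the [t] found for denominator [b]. *)
have [t' [Et1' Et2']] := aux s s s0.
suff -> : tau s = t by [].
move/eqP: Et2; rewrite Et2' (inj_eq (addIr _)) => /eqP/alg_inj <-.
move: Et1'; rewrite mulfV // scale1r -[LHS]addr0 -(scale0r 1) -[X in X + _ = _]scale1r.
rewrite -[RHS]addr0 -[X in _ = _ + X](scale0r 1) => /(lin_inj nN')[E _].
by rewrite -[t'](@divfK _ (tau s)) ?tau_neq0 // -E mul1r.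
Qed.

Lemma npres_sqz N s : N * N = 0 ->
  phi (s *: N) = tau s *: phi N /\ phi (s%:A - N) = (tau s)%:A - phi N.
Proof.
move=> NN; have [NN' NNo] := qpres_sqz_opp NN.
have [->|N0] := eqVneq N 0; first by rewrite scaler0 p0 scaler0 !subr0.
have [->|s0] := eqVneq s 0; first by rewrite tau0 !scale0r p0 !sub0r.
have [E1 ->] := npres_sqz_neq0 NN N0 s0 (oner_neq0 _); split=> //.
by move: E1; rewrite npres_tau1 !divr1.
Qed.

Hypothesis exists_sqz : exists N, N * N = 0 /\ N != 0.

(** Comparing two expressions for the image of [(s / b) *: N] shows that [tau] respects quotients,
    and products are quotients by inverses. *)
Lemma npres_tauM x y : tau (x * y) = tau x * tau y.
Proof.
have [N [NN N0]] := exists_sqz; have nN' := nons (sqz_nonscal NN N0).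
have tV b : b != 0 -> forall s, s != 0 -> tau (s / b) = tau s / tau b.
  move=> b0 s s0; have [E _] := npres_sqz_neq0 NN N0 s0 b0.
  move: E; rewrite (proj1 (npres_sqz (s / b) NN)) -[LHS]addr0 -[RHS]addr0 -(scale0r 1).
  by case/(lin_inj nN').
have [->|x0] := eqVneq x 0; first by rewrite mul0r tau0 mul0r.
have [->|y0] := eqVneq y 0; first by rewrite mulr0 tau0 mulr0.
rewrite -{1}[y]invrK tV ?invr_eq0 // -[y^-1]mul1r tV ?oner_eq0 //.
by rewrite npres_tau1 mul1r invrK.
Qed.

Let tauN1 : tau (-1) = -1.
Proof.
have [N [NN N0]] := exists_sqz; have nN' := nons (sqz_nonscal NN N0).
have := proj1 (npres_sqz (-1) NN); rewrite scaleN1r (proj2 (qpres_sqz_opp NN)).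
rewrite -scaleN1r -[LHS]addr0 -[RHS]addr0 -(scale0r 1).
by case/(lin_inj nN').
Qed.

Lemma npres_idem P s : ~ scal P -> P * P = P ->
  [/\ phi P * phi P = phi P, phi (s *: P) = tau s *: phi P &
      phi (s%:A - P) = (1 + tau (s - 1))%:A - phi P].
Proof.
move=> nP PP; have nP' := nons nP.
have P1 : P * P = 1 *: P by rewrite PP scale1r.
have [t tE] := sq P1.
have aux r b : b != 0 -> exists r', phi (((r - 1) / b) *: P) = ((r' - t) / tau b) *: phi P /\
    phi (r%:A - P) = r'%:A - phi P.
  move=> b0; have [r' [p [E E']]] := npres_conj_alg r b0 P1 tE.
  exists r'; split=> //; rewrite E; move: E; set x := _ / b => E.
  (* The row ([P], [x *: P]) makes [phi P] act on [phi (x *: P)] by the same scalar as on itself;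
     this excludes [p]. *)
  have [||t' [e1]] := @npres_row 1 P (x *: P); rewrite ?scale1r -?scalerAr ?PP //.
  rewrite E -scalerAr scalerA [t' * _]mulrC -(scalerA _ t').
  move/(scalerI (invr_neq0 (tau_neq0 b0))).
  rewrite {1}/lin mulrDr -scalerAr e1 mulr_algr scalerA -scalerDl linZ -[LHS]addr0 -(scale0r 1).
  case/(lin_inj nP') => e2 _; have -> : p = 0 by apply: (addrI ((r' - t) * t')); rewrite e2; ring.
  by rewrite /lin scale0r addr0 scalerA mulrC.
have aux2 r : phi (r%:A - P) = (t + tau (r - 1))%:A - phi P.
  have [r1|r1] := eqVneq (r - 1) 0.
    have [r' [E ->]] := aux r 1 (oner_neq0 _).
    move: E; rewrite r1 mul0r scale0r p0 tau0 npres_tau1 divr1 addr0.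
    by rewrite -[RHS]addr0 -[X in _ = _ + X](scale0r 1) => /esym/(lin_eq0 nP')[/subr0_eq -> _].
  (* With [b = r - 1] the left side is [phi P], hence [r' - t = tau (r - 1)]. *)
  have [r' [E ->]] := aux r _ r1; congr (_%:A - _).
  move: E; rewrite mulfV // scale1r => E.
  have [E1 _] : 1 = (r' - t) / tau (r - 1) /\ 0 = 0 :> F.
    by apply: (lin_inj nP'); rewrite -linE {1}E /lin scale0r addr0.
  by rewrite -[tau _]mul1r {1}E1 divfK ?tau_neq0 // addrC subrK.
have aux3 r : phi (r *: P) = tau r *: phi P.
  have [r' [E E']] := aux (r + 1) 1 (oner_neq0 _).
  move: E; rewrite addrK divr1 npres_tau1 divr1 => ->.
  move: E'; rewrite aux2 addrK => /addIr/alg_inj <-.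
  by rewrite addrC addKr.
have t1 : t = 1.
  (* The two formulas for [phi (- P)] differ by the scalar [t - 1]. *)
  have := aux2 0; rewrite scale0r !sub0r -scaleN1r aux3 tauN1 addrC.
  rewrite scaleN1r -[LHS]addr0 => /addrI/esym/alg_eq0/eqP.
  by rewrite subr_eq0 => /eqP.
by split=> //; [rewrite tE t1 scale1r|rewrite aux2 t1].
Qed.

Lemma nonscal_opp P : ~ scal P -> ~ scal (1 - P).
Proof.
move=> nP [c E]; apply: nP; exists (1 - c).
by rewrite scalerBl scale1r -E subKr.
Qed.

(** Write [s + P] as [(s + 1) - (1 - P)] and use the formula for the idempotent [1 - P]. *)
Lemma npres_idem_shift P s : ~ scal P -> P * P = P -> phi (s%:A + P) = (tau s)%:A + phi P.
Proof.
move=> nP PP.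
have QQ : (1 - P) * (1 - P) = 1 - P by rewrite mulrBl mul1r mulrBr mulr1 PP subrr subr0.
have E1 : phi (1 - P) = 1 - phi P.
  by have [_ _] := npres_idem 1 nP PP; rewrite scale1r subrr tau0 addr0 scale1r.
have [_ _] := npres_idem (s + 1) (nonscal_opp nP) QQ.
rewrite E1 addrK !scalerDl !scale1r !opprB.
by rewrite [P - 1]addrC [phi P - 1]addrC !addrA addrK [1 + _]addrC addrK.
Qed.

(** For [A = 0] and [B = X^-1] the lower left block of the completion is an arbitrary multiple of
    [X], and its image is a multiple of the fixed element [(phi X^-1)^-1]. *)
Lemma qpres_scale_unit X y : X \is a GRing.unit -> exists m, phi (y *: X) = m *: phi X.
Proof.
move=> uX; have uV : X^-1 \is a GRing.unit by rewrite unitrV.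
have aux z : exists m, phi (z *: X) = m *: (phi X^-1)^-1.
  have [s [p [E _]]] := qpres_conj 0 z (-1) h uV; exists (- p).
  move: E; rewrite p0 !scaler0 !sub0r !mulr0 !subr0 mulrN1 invrK !scaleNr opprK.
  by rewrite mulr_algr => ->; rewrite mulrN mulr_algr.
have [m1] := aux 1; rewrite scale1r => E1; have [m2 E2] := aux y.
have m10 : m1 != 0.
  apply/eqP => m10; have := proj2 (qpres_unit X h) uX.
  by rewrite E1 m10 scale0r unitr0.
by exists (m2 / m1); rewrite E2 E1 scalerA divfK.
Qed.

(** For [s] other than 0 and 1, [phi (s - P)] is known from [npres_idem] and also as a multiple of
    the image of the unit [P - s]. Equating both gives [tau s = 1 + tau (s - 1)]; multiplicativity
    does the rest. *)
Lemma npres_tauD x y : tau (x + y) = tau x + tau y.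
Proof.
have [P [nP PP _]] := @nonunit_idem 0 (negbT (unitr0 R)).
have nP' := nons nP.
have step s : tau s = 1 + tau (s - 1).
  have [->|s0] := eqVneq s 0; first by rewrite sub0r tauN1 tau0 subrr.
  have [->|s1] := eqVneq s 1; first by rewrite subrr tau0 npres_tau1 addr0.
  have uX : (- s)%:A + P \is a GRing.unit.
    have e : s * (1 - s) != 0 by rewrite mulf_neq0 // subr_eq0 eq_sym.
    (* The inverse comes from (P - s)(P + s - 1) = s(1 - s). *)
    apply/unitrP; exists ((s * (1 - s))^-1 *: lin P 1 (s - 1)).
    have PP1 : P * P = 1 *: P by rewrite PP scale1r.
    have -> : (- s)%:A + P = lin P 1 (- s) by rewrite /lin scale1r addrC.
    rewrite -scalerAl -scalerAr !(linM _ _ _ _ PP1) !linZ.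
    have -> : 1 = lin P 0 1 by rewrite /lin scale0r add0r scale1r.
    by split; congr lin; field; rewrite s0 subr_eq0 eq_sym s1.
  have [m] := qpres_scale_unit (-1) uX.
  rewrite npres_idem_shift // scaleN1r opprD scaleNr opprK; have [_ _ ->] := npres_idem s nP PP.
  rewrite scalerDr scalerA => E.
  have [<- ->] : -1 = m /\ 1 + tau (s - 1) = m * tau (- s).
    by apply: (lin_inj nP'); rewrite /lin scaleN1r addrC E addrC.
  by rewrite -[- s]mulN1r npres_tauM tauN1 !mulN1r opprK.
have step' s : tau (s + 1) = tau s + 1 by rewrite step addrK addrC.
have [->|y0] := eqVneq y 0; first by rewrite tau0 !addr0.
have -> : x + y = (x / y + 1) * y by rewrite mulrDl mul1r divfK.
by rewrite npres_tauM step' mulrDl mul1r -npres_tauM divfK.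
Qed.

(** Either [k = 0] and [Y] squares to zero, or [Y] is [k] times an idempotent; this puts both cases
    under one statement. *)
Lemma npres_sq Y k s : ~ scal Y -> Y * Y = k *: Y ->
  [/\ phi Y * phi Y = tau k *: phi Y, phi (s *: Y) = tau s *: phi Y &
      phi (s%:A - Y) = (tau s)%:A - phi Y].
Proof.
move=> nY YY; have nY' := nons nY.
have [k0|k0] := eqVneq k 0.
  have NN : Y * Y = 0 by rewrite YY k0 scale0r.
  have [-> ->] := npres_sqz s NN; have [-> _] := qpres_sqz_opp NN.
  by rewrite k0 tau0 scale0r.
set P := k^-1 *: Y.
have EY : Y = k *: P by rewrite /P scalerA mulfV // scale1r.
have PP : P * P = P by rewrite /P -scalerAl -scalerAr YY (scalerA k^-1 k) mulVf // scale1r.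
have nP : ~ scal P by case=> c Ec; apply: nY; exists (k * c); rewrite EY Ec scalerA.
have EY' c : phi (c *: Y) = tau c *: phi Y.
  have [_ EP _] := npres_idem (c * k) nP PP; have [_ EP' _] := npres_idem k nP PP.
  by rewrite EY scalerA EP EP' npres_tauM scalerA.
have YY' : phi Y * phi Y = tau k *: phi Y.
  have [PP' EP _] := npres_idem k nP PP.
  by rewrite {1 2}EY EP -scalerAl -scalerAr PP' -EP -EY.
split=> //; have [s' [p [E ->]]] := npres_conj_alg s (oner_neq0 F) YY YY'.
have [E1 _] : tau (s - k) = s' - tau k /\ 0 = p.
  apply: (lin_inj nY'); move: E; rewrite divr1 npres_tau1 invr1 scale1r => <-.
  by rewrite EY' /lin scale0r addr0.
by rewrite -[s'](subrK (tau k)) -E1 -npres_tauD subrK.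
Qed.

(** The coefficients of [X] on the two sides are [k + 2 e] and [k], and 2 is invertible. *)
Lemma sq_shift X k e : ~ scal X -> X * X = k *: X ->
  (X + e%:A) * (X + e%:A) = k *: (X + e%:A) -> e = 0.
Proof.
move=> nX XX; have -> : X + e%:A = lin X 1 e by rewrite /lin scale1r.
rewrite (linM _ _ _ _ XX) linZ => /(lin_inj nX)[E _].
have /eqP : 2%:R * e = 0 by apply: (addrI k); rewrite addr0 -[RHS]mulr1 -E; ring.
by rewrite mulf_eq0 (negPf charF2) => /eqP.
Qed.

Lemma nonscal_conj X B : B \is a GRing.unit -> ~ scal X -> ~ scal (B^-1 * X * B).
Proof.
move=> uB nX [c E]; apply: nX; exists c.
have -> : X = B * (B^-1 * X * B) * B^-1 by rewrite !mulrA mulrK // mulrV // mul1r.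
by rewrite E mulr_algr -scalerAl divrr.
Qed.

Lemma conj_sq X B k : B \is a GRing.unit -> X * X = k *: X ->
  (B^-1 * X * B) * (B^-1 * X * B) = k *: (B^-1 * X * B).
Proof.
move=> uB XX; rewrite -!mulrA mulVKr // [X * (X * B)]mulrA XX -scalerAl -scalerAr.
by [].
Qed.

(** * Normalised maps that fix the scalars *)

Hypothesis tauE : forall c, tau c = c.

Lemma fixed_lmul A B k : B \is a GRing.unit -> ~ scal A -> A * A = k *: A ->
  phi A = A -> phi B = B -> phi (B^-1 * A) = B^-1 * A.
Proof.
move=> uB nA AA fA fB; set X := B^-1 * A * B.
have nX : ~ scal X := nonscal_conj uB nA.
have XX : X * X = k *: X := conj_sq uB AA.
have AA' : phi A * phi A = k *: phi A by rewrite fA.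
(* The choice [s = k + 1] turns the factor [s - k] in front of [B^-1 * A] into 1. *)
have [s' [p []]] := qpres_conj_sq (k + 1) h uB AA AA'.
have [XX' _ ->] := npres_sq (k + 1) nX XX; rewrite fA fB tauE -/X => E1 E2.
have EX : phi X = X + (k + 1 - s')%:A.
  rewrite scalerBl -[phi X](subKr (k + 1)%:A) E2 opprB.
  by rewrite addrCA.
have es : k + 1 - s' = 0.
  by apply: (sq_shift nX XX); rewrite -EX XX' tauE.
move: E1; rewrite -(subr0_eq es) addrAC subrr add0r scale1r => E1.
(* At this point the image is [B^-1 * (A + p)]; the column with blocks [B^-1 * A] and [A] rules out
   a nonzero [p]. *)
have BA : B^-1 * A * A = k *: (B^-1 * A) by rewrite -mulrA AA scalerAr.
have [t [At]] := npres_col AA BA; rewrite fA in At *.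
rewrite E1 -mulrA scalerAr => /(mulrI (etrans (unitrV _) uB)).
rewrite {1}/lin mulrDl scale1r mulr_algl At -scalerDl linZ -[LHS]addr0 -(scale0r 1).
case/(lin_inj nA) => tp _; have -> : p = 0 by apply: (addrI t); rewrite tp mulr1 addr0.
by rewrite -linE.
Qed.

(** The comparison of [fixed_lmul] with [phi B] as the unknown. Summed over the diagonal matrix
    units [A], the conclusion recovers [phi B]. *)
Lemma fixed_unit A B k : B \is a GRing.unit -> ~ scal A -> A * A = k *: A ->
  phi A = A -> phi (B^-1 * A) = B^-1 * A -> phi (B^-1 * A * B) = B^-1 * A * B ->
  (phi B)^-1 * A = B^-1 * A.
Proof.
move=> uB nA AA fA fBA; set X := B^-1 * A * B => fX.
have uB' : phi B \is a GRing.unit by apply: (proj2 (qpres_unit B h)).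
have nX : ~ scal X := nonscal_conj uB nA.
have XX : X * X = k *: X := conj_sq uB AA.
have AA' : phi A * phi A = k *: phi A by rewrite fA.
have [s' [p []]] := qpres_conj_sq (k + 1) h uB AA AA'.
have [_ _ ->] := npres_sq (k + 1) nX XX; rewrite fA fX tauE -/X => E1 E2.
set X' := (phi B)^-1 * A * phi B in E2.
have EX : X' = X + (s' - (k + 1))%:A.
  rewrite scalerBl -[X'](subKr s'%:A) -E2 opprB.
  by rewrite addrCA.
have es : s' - (k + 1) = 0.
  by apply: (sq_shift nX XX); rewrite -EX; apply: conj_sq.
move: E1; rewrite (subr0_eq es) addrAC subrr add0r scale1r fBA => E1.
have : (phi B)^-1 * (lin A 1 p * A) = (phi B)^-1 * (k *: lin A 1 p).
  by rewrite mulrA -E1 -mulrA AA -!scalerAr E1.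
move/(mulrI (etrans (unitrV _) uB')); rewrite {1}/lin mulrDl scale1r mulr_algl AA.
rewrite -scalerDl linZ -[LHS]addr0 -(scale0r 1).
case/(lin_inj nA) => tp _; have p00 : p = 0 by apply: (addrI k); rewrite tp mulr1 addr0.
by rewrite E1 p00 -linE.
Qed.

End Normalised.

(** * Normalising, inverting, scaling and composing preservers *)

Lemma qpres_npres phi psi : qpres phi psi -> phi 1 = 1 -> exists tau, npres phi psi tau.
Proof.
move=> h p1.
have hs c : exists a, phi c%:A == a%:A.
  by have [a E] := qpres_algP c (qpres_sym h); exists a; apply/eqP.
by exists (fun c => xchoose (hs c)); split=> // c; apply/eqP/(xchooseP (hs c)).
Qed.

Lemma npres_sym phi psi tau : npres phi psi tau -> exists2 tau', npres psi phi tau' &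
  cancel tau tau' /\ cancel tau' tau.
Proof.
case=> h p1 pc; have [K K' _] := h.
have [tau' [h' q1 qc]] := qpres_npres (qpres_sym h) (etrans (congr1 psi (esym p1)) (K 1)).
exists tau' => //; split=> c; apply: alg_inj.
  by rewrite -qc -pc K.
by rewrite -pc -qc K'.
Qed.

Lemma quad2_scale u A B C D : quad2 A B C D -> quad2 (u *: A) (u *: B) (u *: C) (u *: D).
Proof.
case=> a [b [h1 h2 h3 h4]]; exists (u * a), (u * b).
rewrite -!scalerAl -!scalerAr -!scalerDr h1 h2 h3 h4 -mulrDr.
by split; rewrite ?scalerBr !scalerA; [congr (_ *: _ - _ *: _)|congr (_ *: _)
  |congr (_ *: _)|congr (_ *: _ - _ *: _)]; ring.
Qed.

Lemma qpres_scale phi psi u : u != 0 -> qpres phi psi ->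
  qpres (fun X => u *: phi X) (fun X => psi (u^-1 *: X)).
Proof.
move=> u0 [K K' h]; split=> [X|X|A B C D].
- by rewrite scalerA mulVf // scale1r K.
- by rewrite K' scalerA mulfV // scale1r.
rewrite h; split; first exact: quad2_scale.
by move/(quad2_scale u^-1); rewrite !scalerA mulVf // !scale1r.
Qed.

Lemma qpres_comp phi psi f g : qpres phi psi -> qpres f g -> qpres (f \o phi) (psi \o g).
Proof.
move=> [K K' h] [L L' l]; split=> [X|X|A B C D] /=; first by rewrite L K.
- by rewrite K' L'.
- by rewrite h l.
Qed.

(** Serves both for entrywise field automorphisms and, with [sigma] the identity, for
    conjugations. *)
Lemma quad2_semilinear (f : R -> R) (sigma : F -> F) A B C D :
  {morph f : X Y / X + Y} -> {morph f : X Y / X * Y} -> f 1 = 1 ->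
  (forall a X, f (a *: X) = sigma a *: f X) ->
  {morph sigma : a b / a + b} -> {morph sigma : a b / a * b} ->
  quad2 A B C D -> quad2 (f A) (f B) (f C) (f D).
Proof.
move=> fD fM f1 fZ sD sM [a [b [h1 h2 h3 h4]]]; exists (sigma a), (sigma b).
have fB X Y : f (X - Y) = f X - f Y.
  by apply: (addIr (f Y)); rewrite -fD !subrK.
by rewrite -!fM -!fD h1 h2 h3 h4 !fB !fZ f1 sD sM.
Qed.
End Algebra.

(** * Matrix algebras *)

Lemma additive_multiplicative_rmorphism (F : fieldType) (tau : F -> F) :
  (forall x y, tau (x + y) = tau x + tau y) -> (forall x y, tau (x * y) = tau x * tau y) ->
  tau 1 = 1 -> exists f : {rmorphism F -> F}, f =1 tau.
Proof.
move=> tD tM t1.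
have tB : zmod_morphism tau.
  by move=> x y; apply: (addIr (tau y)); rewrite -tD !subrK.
pose f : {rmorphism F -> F} := HB.pack tau
  (GRing.isZmodMorphism.Build F F tau tB) (GRing.isMonoidMorphism.Build F F tau (t1, tM)).
by exists f.
Qed.

Section Matrices.
Variables (F : fieldType) (m : nat).
Hypothesis charF2 : 2%:R != 0 :> F.
Local Notation n := m.+2.
Local Notation M := 'M[F]_n.
Local Notation E := (@delta_mx F n n).
Implicit Types (X Y Z A B : M) (i j k l : 'I_n).

(** * Rank one matrices, and the algebraic hypotheses for matrices *)

Lemma rank1_nonscal (u : 'cV[F]_n) (v : 'rV[F]_n) : u *m v != 0 -> ~ scal (u *m v : M).
Proof.
move=> nz [c Ec]; have c0 : c != 0.
  by apply: contraNneq nz => c0; rewrite Ec c0 scale0r.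
have : (\rank (u *m v) <= 1)%N by apply: leq_trans (mxrankM_maxl _ _) (rank_leq_col _).
by rewrite Ec mxrank_scale_nz // mxrank1.
Qed.

Lemma rank1_sq (u : 'cV[F]_n) (v : 'rV[F]_n) :
  (u *m v : M) * (u *m v) = ((v *m u) 0 0) *: (u *m v).
Proof.
rewrite -mulmxE mulmxA -[u *m v *m u]mulmxA [v *m u]mx11_scalar mul_mx_scalar.
by rewrite -scalemxAl -mx11_scalar.
Qed.

Lemma deltaM i j k l : E i j * E k l = E i l *+ (j == k).
Proof. exact: mul_delta_mx_cond. Qed.

Lemma delta_split i j : E i j = (delta_mx i 0 : 'cV_n) *m (delta_mx 0 j : 'rV_n).
Proof. by rewrite mul_delta_mx. Qed.

Lemma delta_neq0 i j : E i j != 0.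
Proof.
by apply/eqP => /matrixP/(_ i j)/eqP; rewrite !mxE !eqxx oner_eq0.
Qed.

Lemma delta_nonscal i j : ~ scal (E i j).
Proof. by rewrite delta_split; apply: rank1_nonscal; rewrite -delta_split delta_neq0. Qed.

Lemma center_scal_mx Z : (forall Y, Z * Y = Y * Z) -> scal Z.
Proof.
move=> cZ; exists (Z 0 0); apply/matrixP => k j.
have := cZ (E j 0); move/matrixP => /(_ k 0).
rewrite -mulmxE !mxE (bigD1 j) //= big1 ?addr0 => [|l /negPf lj]; last by rewrite mxE lj mulr0.
rewrite (bigD1 0) //= big1 ?addr0 => [|l /negPf l0]; last by rewrite mxE l0 andbF mul0r.
by rewrite !mxE !eqxx mulr1 andbT => ->; rewrite mulr_natl mulr_natr.
Qed.

(** Choose a row [v] with [v X = 0] and a column [u] with [v u = 1]; the complement [1 - u v] of a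
    rank one idempotent works. *)
Lemma nonunit_idem_mx X : X \isn't a GRing.unit ->
  exists D : M, [/\ ~ scal D, D * D = D & D * X = X].
Proof.
rewrite -[X \is a _]/(X \in unitmx) unitmxE unitfE negbK => /det0P[v v0 vX].
have [j vj] : exists j, v 0 j != 0.
  by apply/existsP; apply: contraNT v0 => /existsPn h; apply/eqP/rowP => j;
     rewrite mxE; apply/eqP/negPn.
pose u : 'cV[F]_n := (v 0 j)^-1 *: delta_mx j 0.
have vu : v *m u = 1%:M.
  rewrite -scalemxAr -colE [col _ _]mx11_scalar mxE -scalemx1 scalerA mulVf //.
  by rewrite scale1r.
have D1 : (u *m v : M) * (u *m v) = u *m v by rewrite rank1_sq vu mxE eqxx scale1r.
have D0 : u *m v != 0.
  apply/eqP => D0; have : v *m (u *m v) = 0 by rewrite D0 mulmx0.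
  by rewrite mulmxA vu mul1mx => ve; rewrite ve eqxx in v0.
exists (1 - u *m v : M); split; first exact: nonscal_opp (rank1_nonscal D0).
  by rewrite mulrBl mul1r mulrBr mulr1 D1 subrr subr0.
by rewrite mulrBl mul1r -mulmxE -mulmxA vX mulmx0 subr0.
Qed.

Lemma exists_sqz_mx : exists N : M, N * N = 0 /\ N != 0.
Proof. by exists (E 0 1); rewrite delta_neq0 deltaM. Qed.

Local Notation cs := (@center_scal_mx).
Local Notation ni := (@nonunit_idem_mx).

(** * The images of the matrix units form a system of matrix units *)

Section MatrixUnits.
Variables (phi psi : M -> M) (tau : F -> F).
Hypothesis hn : npres phi psi tau.

Let h : qpres phi psi. Proof. by case: hn. Qed.
Let hq A B C D : quad2 A B C D -> quad2 (phi A) (phi B) (phi C) (phi D).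
Proof. by case: h => _ _ hh; apply: (proj1 (hh _ _ _ _)). Qed.
Let p0 : phi 0 = 0. Proof. exact: (qpres0 cs ni h). Qed.
Let f i j := phi (E i j).
Let nf i j : ~ scal (f i j).
Proof. by rewrite (qpres_scal cs ni _ h); apply: delta_nonscal. Qed.

Let ff i : f i i * f i i = f i i.
Proof.
have [] // := npres_idem cs ni hn exists_sqz_mx 0 (@delta_nonscal i i).
by rewrite deltaM eqxx.
Qed.

Let one_of t i : f i i * f i i = t *: f i i -> t = 1.
Proof.
rewrite ff => /esym e; have [] // := @lin_inj F M (f i i) t 0 1 0 (@nf i i).
by rewrite /lin scale0r !addr0 scale1r.
Qed.

Let frow i j : f i i * f i j = f i j.
Proof.
have [||t [/one_of ->]] := @npres_row F M cs ni _ _ _ hn 1 (E i i) (E i j).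
- by rewrite deltaM eqxx scale1r.
- by rewrite deltaM eqxx scale1r.
by rewrite scale1r.
Qed.

Let fcol i j : f i j * f j j = f i j.
Proof.
have [||t [/one_of ->]] := @npres_col F M cs ni _ _ _ hn 1 (E i j) (E j j).
- by rewrite deltaM eqxx scale1r.
- by rewrite deltaM eqxx scale1r.
by rewrite scale1r.
Qed.

(** The antidiagonal block matrix makes the product a scalar [q]; multiplying by the idempotent
    [f i i] gives [q *: f i i = q], so [q = 0]. *)
Let fdiag i j : i != j -> f i i * f j j = 0.
Proof.
move=> ij; have /hq : quad2 0 (E i i) (E j j) 0.
  have zij : E i i * E j j = 0 by rewrite deltaM (negPf ij).
  have zji : E j j * E i i = 0 by rewrite deltaM eq_sym (negPf ij).
  by apply: (@quad2_of_idem F M 0); rewrite ?zij ?zji !(mulr0, mul0r, addr0, scale0r).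
rewrite p0 => /quad2_anti[q [e _]].
have : f i i * (f i i * f j j) = f i i * f j j by rewrite mulrA ff.
rewrite -/(f i i) -/(f j j) in e *; rewrite e mulr_algr => /eqP.
rewrite -subr_eq0 -scaleNr => /eqP/(lin_eq0 (@nf i i))[-> _].
by rewrite scale0r.
Qed.

Let forth i j k l : j != k -> f i j * f k l = 0.
Proof.
by move=> jk; rewrite -(fcol i j) -(frow k l) mulrA -(mulrA (f i j)) fdiag // mulr0 mul0r.
Qed.

(** The four units form the product of the block column (e_i, e_l) and the block row (e_j, e_k), so
    the square is a multiple of the matrix. *)
Let quad_units i j k l : exists a b : F,
  [/\ f i j * f i j + f i k * f l j = (a + b) *: f i j - (a * b)%:A,
      f i j * f i k + f i k * f l k = (a + b) *: f i k &
      f l j * f i k + f l k * f l k = (a + b) *: f l k - (a * b)%:A].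
Proof.
have /hq : quad2 (E i j) (E i k) (E l j) (E l k).
  by apply: (@quad2_of_idem F M ((j == i)%:R + (k == l)%:R)); rewrite !deltaM scalerDl !scaler_nat.
by case=> a [b [h1 h2 _ h4]]; exists a, b.
Qed.

Let fback i : f 0 i * f i 0 = f 0 0.
Proof.
have [->|i0] := eqVneq i 0; first exact: ff.
have [a [b [h1 h2 _]]] := quad_units 0 0 i i.
have ab : a + b = 2%:R.
  have [|-> //] := @lin_inj F M (f 0 i) (a + b) 0 2%:R 0 (@nf 0 i).
  by rewrite /lin -h2 frow fcol scaler_nat mulr2n.
have h3 : f 0 i * f i 0 = f 0 0 - (a * b)%:A.
  by apply: (addrI (f 0 0)); rewrite -{1}(ff 0) h1 ab scaler_nat mulr2n addrA.
(* Left multiplication by [f 0 0] fixes the product, which eliminates the scalar [a * b]. *)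
have : f 0 0 * (f 0 i * f i 0) = f 0 i * f i 0 by rewrite mulrA frow.
rewrite h3 mulrBr ff mulr_algr => /addrI/oppr_inj/eqP.
rewrite -subr_eq0 -scaleNr => /eqP/(lin_eq0 (@nf 0 0))[-> _].
by rewrite oppr0 scale0r addr0.
Qed.

Let fcol0 i j : f i j * f j 0 = f i 0.
Proof.
have [->|ij] := eqVneq i j; first exact: frow.
have [->|j0] := eqVneq j 0; first by rewrite fcol.
have [a [b [h1 h2 h4]]] := quad_units 0 0 j i.
have [->|i0] := eqVneq i 0; first exact: fback.
have ji : j != i by rewrite eq_sym.
have [|ab p] := @lin_inj F M (f 0 0) (a + b) (- (a * b)) 1 0 (@nf 0 0).
  by rewrite /lin scaleNr -h1 ff (forth _ _ ji) scale1r scale0r.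
(* The last block equation now reads [f i 0 * f 0 j = f i j]. *)
move: h4; rewrite ab -scaleNr p scale0r addr0 scale1r (forth _ _ ji) addr0 => <-.
by rewrite -mulrA fback fcol.
Qed.

Lemma matrix_units_conj : exists2 V : M, V \is a GRing.unit &
  forall i j, V^-1 * phi (E i j) * V = E i j.
Proof.
have [r [l rl]] : exists r, exists l, f 0 0 r l != 0.
  have [[r l] /= rl|z] := pickP (fun x : 'I_n * 'I_n => f 0 0 x.1 x.2 != 0); first by exists r, l.
  case: (@nf 0 0); exists 0; rewrite scale0r; apply/matrixP => r l.
  by rewrite mxE; apply/eqP; rewrite -[_ == _]negbK; have := z (r, l) => /= ->.
(* Column [j] of [V] is column [l] of [f j 0], row [i] of [U] is row [r] of [f 0 i]; the unit
   relations make [U * V] the nonzero scalar [f 0 0 r l]. *)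
pose V : M := \matrix_(k, j) f j 0 k l; pose U : M := \matrix_(i, k) f 0 i r k.
have UV : U * V = (f 0 0 r l)%:A.
  apply/matrixP => i j; rewrite -mulmxE !mxE.
  transitivity ((f 0 i * f j 0) r l).
    by rewrite -mulmxE mxE; apply: eq_bigr => k _; rewrite !mxE.
  have [<-|ij] := eqVneq i j; first by rewrite fback mulr1.
  by rewrite forth // mxE mulr0.
have uV : V \is a GRing.unit.
  have : ((f 0 0 r l)^-1 *: U) *m V = 1%:M.
    by rewrite -scalemxAl mulmxE UV scalerA mulVf // scale1r.
  by case/mulmx1_unit.
exists V => // i j; apply: (mulrI uV); rewrite !mulrA mulrV // mul1r.
apply/matrixP => k q; transitivity ((f i j * f q 0) k l).
  by rewrite -!mulmxE !mxE; apply: eq_bigr => p _; rewrite !mxE.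
set w := LHS; rewrite -mulmxE mxE (bigD1 i) //= big1 ?addr0 {}/w; last first.
  by move=> p /negPf pi; rewrite !mxE pi mulr0.
rewrite [V _ _]mxE [E _ _ _ _]mxE eqxx; have [->|qj] := eqVneq q j; first by rewrite fcol0 mulr1.
by rewrite forth 1?eq_sym // mxE mulr0.
Qed.

End MatrixUnits.
Lemma quad2_tr A B C D : quad2 A B C D -> quad2 A^T C^T B^T D^T.
Proof.
have tM X Y : X^T * Y^T = (Y * X)^T by rewrite -!mulmxE trmx_mul.
have t1 : (1 : M)^T = 1 by exact: trmx1.
case=> a [b [h1 h2 h3 h4]]; exists a, b.
by rewrite !tM -!raddfD h1 h2 h3 h4 /= !linearB !linearZ /= t1.
Qed.

(** Conjugating by transposition lets statements about columns be used for rows. *)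
Lemma npres_tr phi psi (tau : F -> F) : npres phi psi tau ->
  npres (fun X : M => (phi X^T)^T) (fun X : M => (psi X^T)^T) tau.
Proof.
case=> -[K K' h] p1 pc; split=> [||c]; last by rewrite !linearZ /= trmx1 pc linearZ /= trmx1.
  split=> [X|X|A B C D]; rewrite ?trmxK ?K ?K' ?trmxK //.
  split=> [/quad2_tr/h/quad2_tr //|q]; rewrite -[A]trmxK -[B]trmxK -[C]trmxK -[D]trmxK.
  by apply: quad2_tr; apply/h; rewrite -[phi A^T]trmxK -[phi B^T]trmxK -[phi C^T]trmxK
     -[phi D^T]trmxK; apply: quad2_tr.
by rewrite trmx1 p1 trmx1.
Qed.

(** * From fixed matrix units to rank one matrices by transvections *)

Section FixedColumns.
Variables (phi psi : M -> M) (tau : F -> F).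
Hypothesis hn : npres phi psi tau.
Hypothesis tauE : forall c, tau c = c.
Hypothesis fixed_delta : forall i j, phi (E i j) = E i j.

Lemma delta_mulmx i j (x : 'cV[F]_n) : E i j *m x = x j 0 *: delta_mx i 0.
Proof.
apply/colP => k; rewrite !mxE (bigD1 j) //= big1 => [|l /negPf lj]; last first.
  by rewrite mxE lj andbF mul0r.
by rewrite mxE !eqxx !andbT addr0 mulrC.
Qed.

(** A transvection is the inverse of [1 - N], which [phi] fixes because [N] squares to zero; so
    [fixed_lmul] applies. *)
Lemma fixed_transvection i j (t : F) A (k : F) : i != j -> ~ scal A -> A * A = k *: A ->
  phi A = A -> phi ((1 + t *: E i j) * A) = (1 + t *: E i j) * A.
Proof.
move=> ij nA AA fA; set N := t *: E i j.
have EE : E i j * E i j = 0 by rewrite deltaM eq_sym (negPf ij).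
have NN : N * N = 0 by rewrite /N -scalerAl -scalerAr EE !scaler0.
have fN : phi N = N.
  by have [-> _] := npres_sqz cs ni hn t EE; rewrite tauE fixed_delta.
have fB : phi (1 - N) = 1 - N.
  by have [_] := npres_sqz cs ni hn 1 NN; rewrite tauE fN scale1r.
have BG : (1 - N) * (1 + N) = 1 by rewrite mulrBl mul1r mulrDr NN mulr1 addr0 addrK.
have GB : (1 + N) * (1 - N) = 1 by rewrite mulrDl mul1r mulrBr NN mulr1 subr0 subrK.
have uB : 1 - N \is a GRing.unit by apply/unitrP; exists (1 + N).
have -> : 1 + N = (1 - N)^-1 by apply: (mulrI uB); rewrite BG divrr.
exact: (fixed_lmul charF2 cs ni hn exists_sqz_mx tauE uB nA AA).
Qed.

Lemma fixed_columns (v : 'rV[F]_n) :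
  (forall i, phi (delta_mx i 0 *m v) = delta_mx i 0 *m v) ->
  forall x : 'cV[F]_n, phi (x *m v) = x *m v.
Proof.
move=> hv x; have p0 : phi 0 = 0 by case: hn => /(qpres0 cs ni).
have [->|v0] := eqVneq v 0; first by rewrite mulmx0.
have [->|] := eqVneq x 0; first by rewrite mul0mx.
case/cV0Pn => j xj; case/rV0Pn: v0 => l vl.
have nz (y : 'cV[F]_n) : y j 0 != 0 -> y *m v != 0.
  move=> yj; apply/eqP => /matrixP/(_ j l)/eqP.
  by rewrite !mxE big_ord1 mulf_eq0 (negPf yj) (negPf vl).
(* Build [x] coordinate by coordinate, keeping the nonzero entry [j] from the start; each new entry
   is a transvection adding a multiple of row [j]. *)
pose y (k : nat) : 'cV[F]_n := \col_i (if (i == j) || (i < k)%N then x i 0 else 0).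
have yj (k : nat) : y k j 0 = x j 0 by rewrite mxE eqxx.
suff fy (k : nat) : (k <= n)%N -> phi (y k *m v) = y k *m v.
  suff <- : y n = x by apply: fy.
  by apply/colP => i; rewrite mxE ltn_ord orbT.
elim: k => [_|k IHk kn].
  have -> : y 0 = x j 0 *: delta_mx j 0.
    apply/colP => i; rewrite !mxE orbF andbT.
    by case: eqP => [->|_]; rewrite ?mulr1 ?mulr0.
  have nY := rank1_nonscal (nz (delta_mx j 0) _).
  have [|_ E1 _] := npres_sq cs ni hn exists_sqz_mx (x j 0) (nY _) (rank1_sq _ _).
    by rewrite mxE !eqxx oner_eq0.
  by rewrite -scalemxAl E1 tauE hv.
have [ij|ij] := eqVneq (Ordinal kn) j.
  suff -> : y k.+1 = y k by apply/IHk/ltnW.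
  apply/colP => p; rewrite !mxE; case: eqVneq => //= pj.
  rewrite ltnS leq_eqVlt; case: eqVneq => // pk.
  by case/eqP: pj; rewrite -ij; apply: val_inj.
have -> : y k.+1 *m v = (1 + (x (Ordinal kn) 0 / x j 0) *: E (Ordinal kn) j) * (y k *m v).
  rewrite -mulmxE mulmxA mulmxDl -[1]/(1%:M) mul1mx -scalemxAl delta_mulmx scalerA yj divfK //.
  congr (_ *m v); apply/colP => p; rewrite !mxE andbT.
  have [->|pi] := eqVneq p (Ordinal kn).
    by rewrite (negPf ij) /= ltnSn ltnn add0r mulr1.
  rewrite mulr0 addr0 ltnS leq_eqVlt; case: (eqVneq (p : nat) k) => //= pk.
  by case/eqP: pi; apply: val_inj.
apply: (fixed_transvection _ ij _ (rank1_sq _ _)); last by apply/IHk/ltnW.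
by apply/rank1_nonscal/nz; rewrite yj.
Qed.
End FixedColumns.

(** * From rank one matrices to all matrices *)

Section Fixed.
Variables (phi psi : M -> M) (tau : F -> F).
Hypothesis hn : npres phi psi tau.
Hypothesis tauE : forall c, tau c = c.
Hypothesis fixed_delta : forall i j, phi (E i j) = E i j.

Lemma fixed_rank1 (x : 'cV[F]_n) (v : 'rV[F]_n) : phi (x *m v) = x *m v.
Proof.
apply: (fixed_columns hn tauE fixed_delta) => i; apply: trmx_inj.
(* The transposed map settles arbitrary rows [v] with a basis column, the input needed for arbitrary
   columns. *)
have := fixed_columns (npres_tr hn) tauE _ (v := delta_mx 0 i) _ v^T.
rewrite [(v^T *m _)^T]trmx_mul trmxK trmx_mul !trmx_delta; apply=> [k l|k].
  by rewrite trmx_delta fixed_delta trmx_delta.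
by rewrite !mul_delta_mx !trmx_delta fixed_delta trmx_delta.
Qed.

Lemma fixed_invertible B : B \is a GRing.unit -> phi B = B.
Proof.
move=> uB; apply: invr_inj; rewrite -[LHS]mulr1 -[RHS]mulr1.
rewrite -[1]/(1%:M) mx1_sum_delta !mulr_sumr; apply: eq_bigr => i _.
have EE : E i i * E i i = 1 *: E i i by rewrite deltaM eqxx scale1r.
apply: (fixed_unit charF2 cs ni hn exists_sqz_mx tauE uB (@delta_nonscal i i) EE) => //.
  by rewrite delta_split -mulmxE mulmxA fixed_rank1.
by rewrite delta_split -mulmxE mulmxA -mulmxA fixed_rank1.
Qed.

(** In characteristic other than 2, [1 + P] is invertible with inverse [1 - P / 2], hence fixed. *)
Lemma fixed_idem P : ~ scal P -> P * P = P -> phi P = P.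
Proof.
move=> nP PP; apply: (addrI (tau 1)%:A).
rewrite -(npres_idem_shift cs ni hn exists_sqz_mx) // tauE scale1r fixed_invertible //.
have e : 2%:R^-1 + 2%:R^-1 = 1 :> F by field.
have PP1 : P * P = 1 *: P by rewrite PP scale1r.
apply/unitrP; exists (lin P (- 2%:R^-1) 1).
have -> : 1 + P = lin P 1 1 by rewrite /lin !scale1r addrC.
rewrite !(linM _ _ _ _ PP1); have -> : 1 = lin P 0 1 :> M by rewrite /lin scale0r add0r scale1r.
by split; congr lin; field.
Qed.

Lemma fixed_all T : phi T = T.
Proof.
have p0 : phi 0 = 0 by case: hn => /(qpres0 cs ni).
pose L := col_ebase T : M; pose K := row_ebase T : M; pose D := pid_mx (\rank T) : M.
have ET : L * D * K = T by rewrite -mulmxE mulmx_ebase.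
have uL : L \is a GRing.unit by apply: col_ebase_unit.
have uK : K \is a GRing.unit by apply: row_ebase_unit.
have DD : D * D = D by apply: pid_mx_id; apply: rank_leq_row.
(* The rank factorisation [L * D * K] is regrouped as the unit [L * K] times the idempotent [P]. *)
pose P := K^-1 * D * K; have uLK : L * K \is a GRing.unit by rewrite unitrMl.
have {}ET : T = L * K * P by rewrite -ET /P !mulrA mulrK.
have PP : P * P = P by rewrite /P -!mulrA mulVKr // [D * (D * K)]mulrA DD.
have [/is_scalar_mxP[c Pc]|nP] := boolP (is_scalar_mx P).
  have {}Pc : P = c%:A by rewrite Pc -scalemx1.
  have [c0|c0] := eqVneq c 0; first by rewrite ET Pc c0 scale0r mulr0.
  apply: fixed_invertible; by rewrite ET Pc unitrMl // unit_alg.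
have {}nP : ~ scal P.
  by case=> c Pc; case/is_scalar_mxP: nP; exists c; rewrite Pc -scalemx1.
have P1 : P * P = 1 *: P by rewrite PP scale1r.
have uV : (L * K)^-1 \is a GRing.unit by rewrite unitrV.
rewrite ET -[L * K]invrK.
exact: (fixed_lmul charF2 cs ni hn exists_sqz_mx tauE uV nP P1 (fixed_idem nP PP)
  (fixed_invertible uV)).
Qed.
End Fixed.

(** Divide by [u], undo [tau] entrywise, then conjugate the images of the units back to the units;
    the resulting map is the identity by [fixed_all]. *)
Lemma qpres_standard phi psi : qpres phi psi ->
  exists (A : M) (lambda : F) (tau : {rmorphism F -> F}),
    [/\ A \in unitmx, bijective tau &
        forall T : M, phi T = lambda *: (A *m map_mx tau T *m invmx A)].
Proof.
move=> h; have p0 := qpres0 cs ni h.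
have [u Eu] := qpres_algP cs ni 1 (qpres_sym h).
have u0 : u != 0.
  apply/eqP => u0; have [K _ _] := h; move: Eu; rewrite u0 scale0r -p0 => /(can_inj K)/alg_eq0/eqP.
  by rewrite oner_eq0.
have h1 := qpres_scale (invr_neq0 u0) h.
have [|tau hn1] := qpres_npres cs ni h1.
  by move: Eu; rewrite scale1r => ->; rewrite scalerA mulVf // scale1r.
have [tau' hn1' [tK tK']] := npres_sym cs ni hn1.
have [sg Esg] := additive_multiplicative_rmorphism (npres_tauD cs ni hn1 exists_sqz_mx)
  (npres_tauM cs ni hn1 exists_sqz_mx) (npres_tau1 hn1).
have [sg' Esg'] := additive_multiplicative_rmorphism (npres_tauD cs ni hn1' exists_sqz_mx)
  (npres_tauM cs ni hn1' exists_sqz_mx) (npres_tau1 hn1').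
have sK : cancel sg sg' by move=> c; rewrite Esg Esg'.
have sK' : cancel sg' sg by move=> c; rewrite Esg Esg'.
have [_ _ pc] := hn1.
have mapq (rho : {rmorphism F -> F}) A B C D : quad2 A B C D ->
    quad2 (map_mx rho A) (map_mx rho B) (map_mx rho C) (map_mx rho D).
  apply: (quad2_semilinear (f := map_mx rho) (sigma := rho)) => [X Y|X Y||c X||].
  - exact: map_mxD.
  - exact: map_mxM.
  - exact: map_mx1.
  - exact: map_mxZ.
  - exact: rmorphD.
  - exact: rmorphM.
have mapK (r1 r2 : {rmorphism F -> F}) : cancel r1 r2 -> cancel (map_mx r1 : M -> M) (map_mx r2).
  by move=> rK X; apply/matrixP => i j; rewrite !mxE rK.
have hs : qpres (map_mx sg' : M -> M) (map_mx sg).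
  split; [exact: mapK|exact: mapK|move=> A B C D; split; first exact: mapq].
  by move/(mapq sg); rewrite !(mapK _ _ sK').
have h2 := qpres_comp h1 hs.
have mapc c : map_mx sg' (c%:A : M) = (sg' c)%:A by rewrite map_mxZ map_mx1.
have [psi2 hn2] : exists psi2, npres (map_mx sg' \o (fun X => u^-1 *: phi X)) psi2 id.
  eexists; split; [exact: h2| |move=> c]; rewrite /=; last by rewrite pc mapc -Esg sK.
  by rewrite -(scale1r 1) pc mapc -Esg sK.
have [V uV VE] := matrix_units_conj hn2.
have cq W A B C D : W \is a GRing.unit -> quad2 A B C D ->
    quad2 (W^-1 * A * W) (W^-1 * B * W) (W^-1 * C * W) (W^-1 * D * W).
  move=> uW; apply: (quad2_semilinear (f := fun X => W^-1 * X * W) (sigma := id))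
    => [X Y|X Y||c X||] //.
  - by rewrite mulrDr mulrDl.
  - by rewrite !mulrA mulrK.
  - by rewrite mulr1 mulVr.
  - by rewrite -scalerAr -scalerAl.
have hc : qpres (fun X : M => V^-1 * X * V) (fun X => V^-1^-1 * X * V^-1).
  have uV' : V^-1 \is a GRing.unit by rewrite unitrV.
  have K1 W : W \is a GRing.unit -> cancel (fun X => W^-1 * X * W) (fun X => W^-1^-1 * X * W^-1).
    by move=> uW X /=; rewrite invrK !mulrA mulrK // mulrV // mul1r.
  have K2 : cancel (fun X => V^-1^-1 * X * V^-1) (fun X => V^-1 * X * V).
    by move=> X; have := K1 _ uV' X; rewrite /= !invrK.
  split=> [||A B C D]; [exact: K1|exact: K2|split; first exact: cq].
  by move/(cq _ _ _ _ _ uV'); rewrite !(K1 _ uV).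
have [psi3 hn3] : exists psi3,
    npres ((fun X : M => V^-1 * X * V) \o (map_mx sg' \o (fun X => u^-1 *: phi X))) psi3 id.
  have [_ e1 ec] := hn2; eexists; split; first exact: (qpres_comp h2 hc).
    by rewrite /= in e1 *; rewrite e1 mulr1 mulVr.
  by move=> c; rewrite /= in ec *; rewrite ec mulr_algr -scalerAl mulVr.
(* [V] was found after [tau] had been undone, so solving for [phi] applies [sg] to [V] too. *)
exists (map_mx sg V), u, sg; split.
- by rewrite map_unitmx.
- by exists sg'.
move=> T; have /= e := fixed_all hn3 (fun=> erefl) VE T.
have e2 : map_mx sg' (u^-1 *: phi T) = V * T * V^-1.
  by rewrite -[in RHS]e !mulrA mulrK // mulrV // mul1r.
rewrite -map_invmx -!map_mxM -[V *m T *m invmx V]/(V * T * V^-1) -e2 (mapK _ _ sK').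
by rewrite scalerA mulfV // scale1r.
Qed.
End Matrices.

(** * Block matrices *)

Lemma quadraticE (F : fieldType) N (T : 'M[F]_N) : quadratic T <->
  exists a b : F, T *m T = (a + b) *: T - (a * b)%:M.
Proof.
have E (a b : F) : (T - a%:M) *m (T - b%:M) = T *m T - ((a + b) *: T - (a * b)%:M).
  rewrite mulmxBl !mulmxBr !mul_scalar_mx mul_mx_scalar scale_scalar_mx scalerDl.
  by rewrite -addrA -opprD addrCA addrA.
by split=> -[a [b]]; exists a, b; apply/eqP;
  [rewrite -subr_eq0 -E; apply/eqP|rewrite E subr_eq0; apply/eqP].
Qed.

Lemma quadratic_blockmx (F : fieldType) n k (B : 'I_k -> 'I_k -> 'M[F]_n) :
  quadratic (blockmx B) <-> exists a b : F, forall i j,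
    \sum_l B i l *m B l j = (a + b) *: B i j - (if i == j then (a * b)%:M else 0).
Proof.
rewrite quadraticE; split=> -[a [b h]]; exists a, b.
  move=> i j; move: h; rewrite /blockmx mul_mxblock -mul_scalar_mx -!mxdiagZ mul_mxdiag_mxblock.
  rewrite /mxdiag -mxblockB => /eq_mxblockP/(_ i j) ->; rewrite mul_scalar_mx.
  (* Diagonal blocks of [mxdiag] carry a [conform_mx], the identity since all blocks have the same
     size. *)
  by case: eqP => // ij; rewrite conform_mx_id.
rewrite /blockmx mul_mxblock -mul_scalar_mx -!mxdiagZ mul_mxdiag_mxblock /mxdiag -mxblockB.
apply/eq_mxblockP => i j; rewrite h mul_scalar_mx.
by case: eqP => // ij; rewrite conform_mx_id.
Qed.

(** Up to the factor [la], [phi] is a semilinear ring map, so roots [a], [b] become [la * tau a],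
    [la * tau b]. *)
Lemma standard_form_completely (F : fieldType) n (phi : 'M[F]_n.+1 -> 'M[F]_n.+1) :
  bijective phi -> standard_form phi -> completely_quadratic_preserving_both phi.
Proof.
move=> /bij_inj phiI [A [la [tau [uA [tau' tK tK'] E]]]].
have la0 : la != 0.
  apply/eqP => la0; have /phiI/eqP : phi 1 = phi 0 by rewrite !E la0 !scale0r.
  by rewrite oner_eq0.
have phiM X Y : phi X *m phi Y = la *: phi (X *m Y).
  by rewrite !E -scalemxAl -scalemxAr !mulmxA mulmxKV // map_mxM !mulmxA.
have phiB X Y : phi (X - Y) = phi X - phi Y.
  by rewrite !E map_mxB mulmxBr mulmxBl scalerBr.
have phiZ a X : phi (a *: X) = tau a *: phi X.
  by rewrite !E map_mxZ -scalemxAr -scalemxAl !scalerA mulrC.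
have phi1 a : phi a%:M = (la * tau a)%:M.
  by rewrite E map_scalar_mx mul_mx_scalar -scalemxAl mulmxV // scalemx1 scale_scalar_mx.
have phi0 : phi 0 = 0 by rewrite E map_mx0 mulmx0 mul0mx scaler0.
have phiS k (G : 'I_k -> 'M[F]_n.+1) : phi (\sum_l G l) = \sum_l phi (G l).
  apply: (big_morph phi) => // X Y; apply: (addIr (- phi Y)).
  by rewrite -phiB !addrK.
move=> k B; rewrite /phik !quadratic_blockmx.
have step a b : (forall i j, \sum_l B i l *m B l j =
      (a + b) *: B i j - (if i == j then (a * b)%:M else 0)) <->
    (forall i j, \sum_l phi (B i l) *m phi (B l j) =
      (la * tau a + la * tau b) *: phi (B i j) -
      (if i == j then (la * tau a * (la * tau b))%:M else 0)).
  have L i j : \sum_l phi (B i l) *m phi (B l j) = la *: phi (\sum_l B i l *m B l j).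
    by rewrite phiS scaler_sumr; apply: eq_bigr => l _; rewrite phiM.
  have Rt i j : (la * tau a + la * tau b) *: phi (B i j) -
      (if i == j then (la * tau a * (la * tau b))%:M else 0) =
      la *: phi ((a + b) *: B i j - (if i == j then (a * b)%:M else 0)).
    rewrite phiB scalerBr phiZ scalerA rmorphD mulrDr; congr (_ - _).
    case: (i == j); last by rewrite phi0 scaler0.
    by rewrite phi1 rmorphM scale_scalar_mx; congr _%:M; ring.
  split=> h i j; first by rewrite L Rt h.
  by apply/phiI/(scalerI la0); rewrite -L -Rt h.
split=> -[a [b h]]; first by exists (la * tau a), (la * tau b); apply/step.
(* These are the preimages of [a] and [b] under the change of roots. *)
exists (tau' (la^-1 * a)), (tau' (la^-1 * b)); apply/step => i j.
by rewrite !tK' !mulVKf // h.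
Qed.

Lemma quad2_blockmx (F : fieldType) n (B : 'I_2 -> 'I_2 -> 'M[F]_n.+1) :
  quadratic (blockmx B) <-> quad2 (B 0 0 : 'M_n.+1) (B 0 1) (B 1 0) (B 1 1).
Proof.
have sum2 (G : 'I_2 -> 'M[F]_n.+1) : \sum_l G l = G 0 + G 1.
  by rewrite !big_ord_recl big_ord0 addr0; congr (G _ + G _); apply: val_inj.
have i2 (i : 'I_2) : i = 0 \/ i = 1.
  by case: i => -[|[|//]] ?; [left|right]; apply: val_inj.
rewrite quadratic_blockmx; split=> -[a [b h]]; exists a, b.
  move: (h 0 0) (h 0 1) (h 1 0) (h 1 1); rewrite !sum2 /= !scalemx1 !subr0.
  by split.
case: h => h1 h2 h3 h4 i j; rewrite sum2 /= -scalemx1.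
by case: (i2 i) => ->; case: (i2 j) => -> /=; rewrite ?subr0.
Qed.

Lemma k2_quadratic_qpres (F : fieldType) n (phi psi : 'M[F]_n.+1 -> 'M[F]_n.+1) :
  cancel phi psi -> cancel psi phi -> k_quadratic_preserving_both 2 phi -> qpres phi psi.
Proof.
move=> K K' h; split=> // A B C D.
have := h (fun i j => if i == 0 then if j == 0 then A else B else if j == 0 then C else D).
by rewrite /phik !quad2_blockmx.
Qed.

Lemma theorem_conditions_equivP (F : fieldType) m (phi : 'M[F]_m.+2 -> 'M[F]_m.+2) :
  2%:R != 0 :> F -> bijective phi -> theorem_conditions_equiv phi.
Proof.
move=> F2 bij_phi; have h31 := standard_form_completely bij_phi.
have h12 : completely_quadratic_preserving_both phi -> k_quadratic_preserving_both 2 phi by apply.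
have h23 : k_quadratic_preserving_both 2 phi -> standard_form phi.
  by case: bij_phi => psi K K' h; apply: (@qpres_standard F m F2 phi psi);
     apply: k2_quadratic_qpres.
split; split; auto.
Qed.

(* F = R (any model R of the reals) or F = C = R[i]. *)
Theorem theorem1p2 (R : realType) (n : nat) : (3 <= n)%N ->
  (forall phi : 'M[R]_n -> 'M[R]_n, bijective phi -> theorem_conditions_equiv phi) /\
  (forall phi : 'M[R[i]]_n -> 'M[R[i]]_n, bijective phi -> theorem_conditions_equiv phi).
Proof.
case: n => [|[|m]] // _.
by split=> phi; apply: theorem_conditions_equivP; rewrite Num.Theory.pnatr_eq0.
Qed.
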